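(* Let $G$ be a graph, $\theta$ a real number, and $u,v$ distinct vertices in $P_\theta(G)\cup N_\theta(G)$. Then $A_\theta(G)$ is a $\theta$-extreme set in $G\setminus\{u,v\}$, i.e. $\mathrm{mult}(\theta,G\setminus(A_\theta(G)\cup\{u,v\}))=\mathrm{mult}(\theta,G\setminus\{u,v\})+|A_\theta(G)|$.
   Context: All graphs are finite and simple. For a graph $G$ on $n$ vertices, let $p(G,r)$ be the number of $r$-matchings of $G$ ($p(G,0)=1$); the matching polynomial is $\mu(G,x)=\sum_{r=0}^{\lfloor n/2\rfloor}(-1)^r p(G,r)x^{n-2r}$. For real $\theta$, $\mathrm{mult}(\theta,G)$ is the multiplicity of $\theta$ as a root of $\mu(G,x)$ (it is $0$ if $\theta$ is not a root). $G\setminus X$ denotes deletion of the vertex set $X$; $G\setminus u=G\setminus\{u\}$. A vertex $u$ is $\theta$-essential, $\theta$-neutral, or $\theta$-positive in $G$ according as $\mathrm{mult}(\theta,G\setminus u)$ equals $\mathrm{mult}(\theta,G)-1$, $\mathrm{mult}(\theta,G)$, or $\mathrm{mult}(\theta,G)+1$. A vertex is $\theta$-special if it is not $\theta$-essential but is adjacent to a $\theta$-essential vertex. $A_\theta(G)$, $N_\theta(G)$ are the sets of $\theta$-special and $\theta$-neutral vertices, and $P_\theta(G)$ is the set of $\theta$-positive vertices that are not $\theta$-special. A set $X$ is $\theta$-extreme in a graph $F$ if $\mathrm{mult}(\theta,F\setminus X)=\mathrm{mult}(\theta,F)+|X|$. *)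

(* Defs.v *)
From HB Require Import structures.
From mathcomp Require Import all_boot all_order all_algebra.
Set Implicit Arguments. Unset Strict Implicit. Unset Printing Implicit Defensive.
Import Order.TTheory GRing.Theory Num.Theory.
Local Open Scope ring_scope.

Definition simple_graph (T : finType) (e : rel T) : Prop :=
  symmetric e /\ irreflexive e.

Section Matching.
Variables (T : finType) (e : rel T).

Definition is_matching (S : {set T}) (M : {set {set T}}) : bool :=
  [forall m in M, [exists a, exists b, e a b && (m == [set a; b])]]
  && [forall m in M, m \subset S] && trivIset M.

Definition nmatch (S : {set T}) (r : nat) : nat :=
  #|[set M | is_matching S M & #|M| == r]|.

Definition match_poly (R : nzRingType) (S : {set T}) : {poly R} :=
  \sum_(r < (#|S|./2).+1)
     ((-1) ^+ r * (nmatch S r)%:R) *: 'X^(#|S| - r.*2).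

(* mult(theta, G \ X) where G\X is the induced subgraph on ~: X *)
Definition mult (R : realFieldType) (theta : R) (X : {set T}) : nat :=
  mup theta (match_poly R (~: X)).

Section Theta.
Variables (R : realFieldType) (theta : R).

Definition essential (u : T) : bool :=
  (mult theta [set u]).+1 == mult theta set0.
Definition neutral (u : T) : bool :=
  mult theta [set u] == mult theta set0.
Definition positive (u : T) : bool :=
  mult theta [set u] == (mult theta set0).+1.
Definition special (u : T) : bool :=
  ~~ essential u && [exists w, e u w && essential w].

Definition A_set : {set T} := [set u | special u].
Definition N_set : {set T} := [set u | neutral u].
Definition P_set : {set T} := [set u | positive u && ~~ special u].
End Theta.
End Matching.

(* Main.v *)
Require Import Defs.
From HB Require Import structures.
From mathcomp Require Import all_boot all_order all_algebra.
From mathcomp Require Import zify ring.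
Set Implicit Arguments. Unset Strict Implicit. Unset Printing Implicit Defensive.
Import Order.TTheory GRing.Theory Num.Theory.
Local Open Scope ring_scope.

(** The polynomials [mu(G \ X)] satisfy
    [mu(G) = x mu(G \ u) - sum_(y ~ u) mu(G \ u \ y)], and this recursion alone
    makes [mu(G \ u) mu(G \ v) - mu(G) mu(G \ u,v)] and the Wronskian of [mu(G)]
    and [mu(G \ u)] sums of squares. Reading off lowest coefficients at theta
    gives interlacing, the sign of the residues, the persistence of essential
    vertices under deletion of a non-essential one, and (after perturbing the
    weight [x] of one vertex) the transitivity of the relation "deleting both
    essential vertices drops the multiplicity by one only".

    From these follows the stability lemma: deleting a special vertex [a] changes
    the type (essential, neutral or positive) of no other vertex. Iterated, it
    says that for [X] a set of special vertices of [H] and [v] outside [X],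
    [mult(H \ X \ v) = mult(H \ v) + #|X|]. The theorem is the case [H = G \ u],
    [X = A(G)]: since [u] is neither essential nor special, every special vertex
    of [G] is still special in [G \ u]. *)

(** * Lowest coefficients, sums of squares and Wronskians *)

Section LowestCoefficient.
Variable R : realFieldType.
Implicit Types p q : {poly R}.

(** Divisibility of [p] by ['X^n], in a form that the zero polynomial satisfies for every [n]. *)
Definition lowz n p := forall i, (i < n)%N -> p`_i = 0.

Lemma lowzM m n p q : lowz m p -> lowz n q ->
  lowz (m + n) (p * q) /\ (p * q)`_(m + n) = p`_m * q`_n.
Proof.
move=> hp hq; split=> [k hk|]; rewrite coefM.
  apply: big1 => i _; have [him|hmi] := ltnP i m; first by rewrite hp ?mul0r.
  by rewrite hq ?mulr0 //; have := ltn_ord i; lia.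
have hm : (m < (m + n).+1)%N by lia.
rewrite (bigD1 (Ordinal hm)) //= addKn big1 ?addr0 // => i /eqP neq_i.
have {}neq_i : (i : nat) <> m by move=> eq_i; apply: neq_i; apply: val_inj.
have [him|hmi] := ltnP i m; first by rewrite hp ?mul0r.
by rewrite hq ?mulr0 //; have := ltn_ord i; lia.
Qed.

Lemma lowzW m n p : (m <= n)%N -> lowz n p -> lowz m p.
Proof. by move=> hmn hp i hi; apply: hp; apply: leq_trans hmn. Qed.

Lemma lowzXM n p : lowz n p -> lowz n.+1 ('X * p).
Proof. by move=> hp [|i] hi; rewrite coefXM //= hp. Qed.

Lemma lowz_mup p : lowz (mup 0 p) p.
Proof.
have [->|p0] := eqVneq p 0; first by move=> i _; rewrite coef0.
have : ('X - 0%:P) ^+ mup 0 p %| p by rewrite -mup_geq.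
by rewrite subr0 => /dvdpP[q def_p] i hi; rewrite def_p coefMXn hi.
Qed.

Lemma low_neq0 p : p != 0 -> p`_(mup 0 p) != 0.
Proof.
move=> p0; apply/negP => /eqP h; suff : (mup 0 p < mup 0 p)%N by rewrite ltnn.
rewrite mup_geq // subr0; apply/dvdpP; exists (drop_poly (mup 0 p).+1 p).
apply/polyP=> i; rewrite coefMXn; case: ltnP => hi; last first.
  by rewrite coef_drop_poly subnK.
move: hi; rewrite ltnS leq_eqVlt => /orP[/eqP->//|]; exact: lowz_mup.
Qed.

Lemma mup0_le n p : p`_n != 0 -> (mup 0 p <= n)%N.
Proof. by move=> h; rewrite leqNgt; apply: contra h => /(lowz_mup)->. Qed.

Lemma mup0_ge n p : p != 0 -> lowz n p -> (n <= mup 0 p)%N.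
Proof.
by move=> p0 h; rewrite leqNgt; apply/negP => /h/eqP; apply/negP; apply: low_neq0.
Qed.

Lemma mup0_eq n p : lowz n p -> p`_n != 0 -> mup 0 p = n.
Proof.
move=> h hn; apply/eqP; rewrite eqn_leq mup0_le //= mup0_ge //.
by apply: contra hn => /eqP->; rewrite coef0.
Qed.

Definition sos p := exists s : seq {poly R}, p = \sum_(q <- s) q ^+ 2.

Lemma sos0 : sos 0.
Proof. by exists [::]; rewrite big_nil. Qed.

Lemma sosD p q : sos p -> sos q -> sos (p + q).
Proof. by move=> [s ->] [t ->]; exists (s ++ t); rewrite big_cat. Qed.

Lemma sos_sqr p : sos (p ^+ 2).
Proof. by exists [:: p]; rewrite big_seq1. Qed.

Lemma sos_sum (I : Type) (r : seq I) (P : pred I) (F : I -> {poly R}) :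
  (forall i, P i -> sos (F i)) -> sos (\sum_(i <- r | P i) F i).
Proof. by move=> h; apply: big_ind => //; [apply: sos0|apply: sosD]. Qed.

(** Take [n] least such that some member of [s] has a nonzero coefficient at [n]. At index [n.*2]
    each square contributes a square of the field, so nothing cancels. *)
Lemma sum_sqr_low (s : seq {poly R}) (p : {poly R}) : p \in s -> p != 0 ->
  exists n, [/\ (n <= mup 0 p)%N, lowz n.*2 (\sum_(q <- s) q ^+ 2)
               & 0 < (\sum_(q <- s) q ^+ 2)`_n.*2].
Proof.
move=> sp p0.
have ex : exists n, has (fun q : {poly R} => q`_n != 0) s.
  by exists (mup 0 p); apply/hasP; exists p => //; apply: low_neq0.
case: (ex_minnP ex) => n /hasP[q sq qn] nmin.
have low r : r \in s -> lowz n r.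
  move=> sr i hi; apply/eqP; apply/negPn/negP=> ri.
  by have := nmin i; rewrite leqNgt hi => /(_ (introT hasP (ex_intro2 _ _ r sr ri))).
have sqr r : r \in s -> lowz n.*2 (r ^+ 2) /\ (r ^+ 2)`_n.*2 = r`_n ^+ 2.
  by move=> /low lr; rewrite -addnn !expr2; apply: (lowzM lr lr).
exists n; split.
- by apply: mup0_ge => //; apply: low.
- by move=> i hi; rewrite coef_sum big_seq big1 // => r /sqr[l _]; exact: l.
rewrite coef_sum big_seq (eq_bigr (fun r : {poly R} => r`_n ^+ 2)); last first.
  by move=> r /sqr[].
rewrite -big_seq (big_rem q) //= ltr_pwDl //.
  by rewrite lt_def sqr_ge0 sqrf_eq0 qn.
by apply: sumr_ge0 => r _; apply: sqr_ge0.
Qed.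

Lemma sos_low p : sos p -> p != 0 ->
  exists n, mup 0 p = n.*2 /\ 0 < p`_n.*2.
Proof.
move=> [s ->] s0.
have /hasP[q sq q0] : has (fun q : {poly R} => q != 0) s.
  apply: contraNT s0 => /hasPn h; rewrite big_seq big1 // => q /h.
  by rewrite negbK => /eqP->; rewrite expr0n.
have [n [_ lo pos]] := sum_sqr_low sq q0; exists n; split=> //.
by apply: mup0_eq => //; rewrite gt_eqF.
Qed.

Lemma sqrD_sos_low p q : p != 0 -> sos q ->
  exists n, [/\ (n <= mup 0 p)%N, mup 0 (p ^+ 2 + q) = n.*2
               & 0 < (p ^+ 2 + q)`_n.*2].
Proof.
move=> p0 [s ->]; have := @sum_sqr_low (p :: s) p (mem_head _ _) p0.
rewrite big_cons => -[n [h1 h2 h3]]; exists n; split=> //.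
by apply: mup0_eq => //; rewrite gt_eqF.
Qed.

(* The lowest coefficient of the Wronskian of [p] and [q] is
   [(mup 0 p - mup 0 q) * low p * low q]. *)
Lemma wronskian_low p q : p != 0 -> q != 0 ->
  sos (p^`() * q - p * q^`() - q ^+ 2) -> mup 0 p != mup 0 q ->
  (mup 0 p <= (mup 0 q).+1)%N /\
  0 < ((mup 0 p)%:R - (mup 0 q)%:R) * (p`_(mup 0 p) * q`_(mup 0 q)).
Proof.
move=> p0 q0 hs neq; have [n []] := sqrD_sos_low q0 hs.
rewrite addrC subrK; set W := _ - _ => hn mW Wpos.
have XD r i : ('X * r^`())`_i = r`_i *+ i.
  by rewrite coefXM coef_deriv; case: i => [|i]; rewrite ?mulr0n.
have lowXD r : lowz (mup 0 r) ('X * r^`()).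
  by move=> i hi; rewrite XD lowz_mup ?mul0rn.
have XW : 'X * W = 'X * p^`() * q - p * ('X * q^`()) by rewrite /W; ring.
have [l1 c1] := lowzM (lowXD p) (@lowz_mup q).
have [l2 c2] := lowzM (@lowz_mup p) (lowXD q).
have cW : ('X * W)`_(mup 0 p + mup 0 q) =
    ((mup 0 p)%:R - (mup 0 q)%:R) * (p`_(mup 0 p) * q`_(mup 0 q)).
  by rewrite XW coefB c1 c2 !XD mulrBl !mulr_natl -mulrnAl -mulrnAr.
have cW0 : ('X * W)`_(mup 0 p + mup 0 q) != 0.
  by rewrite cW !mulf_neq0 ?low_neq0 // subr_eq0 eqr_nat.
have mXW : mup 0 ('X * W) = (mup 0 p + mup 0 q)%N.
  by apply: mup0_eq => // i hi; rewrite XW coefB l1 // l2 // subr0.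
have mXW' : mup 0 ('X * W) = n.*2.+1.
  apply: mup0_eq; last by rewrite coefXM /= gt_eqF.
  by apply: lowzXM; rewrite -mW; apply: lowz_mup.
(* Together with [n <= mup 0 q] this parity relation gives the bound on [mup 0 p]. *)
have eq_n : (mup 0 p + mup 0 q = n.*2.+1)%N by rewrite -mXW.
by rewrite -cW eq_n coefXM /=; split=> //; lia.
Qed.

(** When [q] vanishes to higher order, [p - q] has the lowest term of [p], and a nonzero sum of
    squares has even order. *)
Lemma sos_sub_even p q : p != 0 -> sos (p - q) ->
  (mup 0 p < mup 0 q)%N -> ~~ odd (mup 0 p).
Proof.
move=> p0 hs lt_pq.
have cpq i : (i <= mup 0 p)%N -> (p - q)`_i = p`_i.
  by move=> hi; rewrite coefB (@lowz_mup q) ?subr0 //; apply: leq_ltn_trans lt_pq.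
have c0 : (p - q)`_(mup 0 p) != 0 by rewrite cpq // low_neq0.
have mpq : mup 0 (p - q) = mup 0 p.
  by apply: mup0_eq => // i hi; rewrite cpq ?lowz_mup // ltnW.
have [|n [mn _]] := sos_low hs; last by rewrite -mpq mn odd_double.
by apply: contraNneq c0 => ->; rewrite coef0.
Qed.

End LowestCoefficient.

(** * The matching recursion and its sum-of-squares identities *)

Section MatchingRecursion.
Variables (T : finType) (e : rel T) (R : realFieldType).
Implicit Types (S X : {set T}) (x : T -> {poly R}) (Z : {set T} -> {poly R}).

Lemma setD1C S u v : S :\ u :\ v = S :\ v :\ u.
Proof. by rewrite !setDDl setUC. Qed.

(** The weight depends on the vertex so that a single one can be perturbed. *)
Definition matching_rec x Z := forall S u, u \in S ->
  Z S = x u * Z (S :\ u) - \sum_(y in S :\ u | e u y) Z (S :\ u :\ y).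

(** Expand [Z S] and [Z (S :\ v)] at [u]: the weights cancel, the neighbour [v] (if it is one)
    leaves a square, and any other neighbour [y] leaves the same expression for [y], [v] in
    [S :\ u]. Unrolled, this is a sum of squares over the paths from [u] to [v]. *)
Lemma christoffel_darboux x Z S u v : matching_rec x Z ->
  u \in S -> v \in S -> u != v ->
  sos (Z (S :\ u) * Z (S :\ v) - Z S * Z (S :\ u :\ v)).
Proof.
move=> recZ; have [n] := ubnP #|S|; elim: n => // n IHn in S u v *.
move=> leSn Su Sv neq_uv.
have Fv : v \in S :\ u by rewrite !inE eq_sym neq_uv.
have ltF : (#|S :\ u| < n)%N by move: leSn; rewrite (cardsD1 u S) Su.
have vu : u \in S :\ v by rewrite !inE neq_uv.
rewrite (recZ (S :\ v) u vu) (recZ S u Su) ![S :\ v :\ u]setD1C.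
rewrite !big_mkcondr (big_setD1 v Fv) /= -!big_mkcondr.
set F := S :\ u in Fv ltF *.
have -> : Z F * (x u * Z (F :\ v) - \sum_(y in F :\ v | e u y) Z (F :\ v :\ y))
  - (x u * Z F - ((if e u v then Z (F :\ v) else 0)
                  + \sum_(y in F :\ v | e u y) Z (F :\ y))) * Z (F :\ v)
  = (if e u v then Z (F :\ v) else 0) * Z (F :\ v)
    + \sum_(y in F :\ v | e u y)
        (Z (F :\ y) * Z (F :\ v) - Z F * Z (F :\ y :\ v)).
  rewrite sumrB -mulr_suml -mulr_sumr.
  by rewrite (eq_bigr _ (fun y _ => congr1 Z (setD1C F v y))); ring.
apply: sosD; first by case: (e u v); [apply: sos_sqr|rewrite mul0r; apply: sos0].
apply: sos_sum => y /andP[]; rewrite !in_setD1 => /and3P[neq_yv neq_yu Sy] _.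
by apply: IHn => //; rewrite !inE neq_yu.
Qed.

(** Expanding at [u], the derivative of the weight produces exactly the subtracted square, and each
    neighbour [y] contributes the Wronskian for [S :\ u] and [y], to which induction applies. *)
Lemma wronskian_sos x Z S u : matching_rec x Z -> (forall w, (x w)^`() = 1) ->
  u \in S ->
  sos ((Z S)^`() * Z (S :\ u) - Z S * (Z (S :\ u))^`() - Z (S :\ u) ^+ 2).
Proof.
move=> recZ dx; have [n] := ubnP #|S|; elim: n => // n IHn in S u *.
move=> leSn Su; have ltF : (#|S :\ u| < n)%N by move: leSn; rewrite (cardsD1 u S) Su.
rewrite (recZ S u Su); set F := S :\ u in ltF *.
rewrite derivB derivM dx (big_morph _ (@derivD _) (deriv0 _)).
have -> : (1 * Z F + x u * (Z F)^`() - \sum_(y in F | e u y) (Z (F :\ y))^`()) * Z F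
    - (x u * Z F - \sum_(y in F | e u y) Z (F :\ y)) * (Z F)^`() - Z F ^+ 2
  = \sum_(y in F | e u y)
      ((Z F)^`() * Z (F :\ y) - Z F * (Z (F :\ y))^`()).
  by rewrite sumrB -!mulr_sumr; ring.
apply: sos_sum => y /andP[Fy _].
rewrite -[X in sos X](subrK (Z (F :\ y) ^+ 2)).
by apply: sosD; [apply: IHn|apply: sos_sqr].
Qed.

(** [Z S] is affine in the weight of [u], with slope [Z (S :\ u)]. *)
Lemma matching_rec_shift x Z u s : matching_rec x Z ->
  matching_rec (fun v => x v + (if v == u then s else 0))
               (fun S => Z S + (if u \in S then s * Z (S :\ u) else 0)).
Proof.
move=> recZ S a Sa /=; rewrite big_split /= (recZ S a Sa).
have [eq_au|neq_au] := eqVneq a u.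
  rewrite -eq_au Sa !inE eqxx /= addr0.
  rewrite [\sum_(_ in _ | _) (if _ then _ else _)]big1 ?addr0; last first.
    by move=> y _; rewrite !inE eqxx andbF.
  by ring.
rewrite addr0 !in_setD1 [u == a]eq_sym neq_au /=.
have [Su|nSu] := boolP (u \in S); last first.
  rewrite !addr0 [\sum_(_ in _ | _) (if _ then _ else _)]big1 ?addr0 // => y _.
  by rewrite !inE (negPf nSu) !andbF.
have Fa : a \in S :\ u by rewrite !inE neq_au.
rewrite (recZ _ a Fa).
have -> : \sum_(y in S :\ a | e a y)
     (if u \in S :\ a :\ y then s * Z (S :\ a :\ y :\ u) else 0)
   = s * \sum_(y in S :\ u :\ a | e a y) Z (S :\ u :\ a :\ y).
  rewrite mulr_sumr -big_mkcondr /=; apply: eq_big => y.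
    rewrite !inE [u == a]eq_sym neq_au Su [u == y]eq_sym andbT.
    by case: (y == a); case: (y \in S); case: (e a y); case: (y == u).
  by move=> _; rewrite [S :\ a :\ y :\ u]setD1C [S :\ a :\ u]setD1C.
by rewrite [S :\ a :\ u]setD1C; ring.
Qed.

Definition zmult Z S := mup 0 (Z S).

(** * Interlacing and signs of lowest coefficients under vertex deletion *)

Section Multiplicity.
Variables (x : T -> {poly R}) (Z : {set T} -> {poly R}).
Hypotheses (recZ : matching_rec x Z) (dx : forall w, (x w)^`() = 1).
Hypothesis Z_neq0 : forall S, Z S != 0.
Local Notation m := (zmult Z).

Lemma mult_le_del S u : u \in S -> (m S <= (m (S :\ u)).+1)%N.
Proof.
move=> Su; have [->|neq] := eqVneq (m S) (m (S :\ u)); first by lia.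
by case: (wronskian_low (Z_neq0 S) (Z_neq0 (S :\ u)) (wronskian_sos recZ dx Su) neq).
Qed.

(** The residue of [Z (S :\ u) / Z S] at 0 is nonnegative. By interlacing, index [d] reads the
    lowest coefficient of [Z (S :\ u)] when [u] is essential, and 0 otherwise. *)
Lemma essential_low_sign S u d : u \in S -> m S = d.+1 ->
  0 <= (Z S)`_d.+1 * (Z (S :\ u))`_d ?= iff (m (S :\ u) != d).
Proof.
move=> Su mS; have := mult_le_del Su; rewrite mS ltnS => le_d.
have [eq_d|neq_d] := eqVneq (m (S :\ u)) d; last first.
  suff -> : (Z (S :\ u))`_d = 0 by rewrite mulr0; split; rewrite ?eqxx.
  by apply: lowz_mup; rewrite -/(m _); lia.
have neq : m S != m (S :\ u) by rewrite mS eq_d; lia.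
case: (wronskian_low (Z_neq0 S) (Z_neq0 (S :\ u)) (wronskian_sos recZ dx Su) neq).
rewrite -/(m S) -/(m (S :\ u)) mS eq_d -natr1 addrAC subrr add0r mul1r => _ h.
by split; [apply: ltW|rewrite lt_eqF].
Qed.

Lemma rec_coef S a d : a \in S -> (d < m (S :\ a))%N ->
  (Z S)`_d = - \sum_(y in S :\ a | e a y) (Z (S :\ a :\ y))`_d.
Proof.
move=> Sa hd; rewrite (recZ Sa) coefB coef_sum.
have l0 : lowz 0 (x a) by [].
have [l _] := lowzM l0 (@lowz_mup _ (Z (S :\ a))).
by rewrite l // sub0r.
Qed.

(** By the other half of interlacing, deleting a neighbour from [S :\ u] costs at most one, so all
    terms of the recursion at [u] vanish to order [m (S :\ u) - 1]. *)
Lemma mult_del_le S u : u \in S -> (m (S :\ u) <= (m S).+1)%N.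
Proof.
move=> Su; have [->//|[d md]] : m (S :\ u) = 0%N \/ exists d, m (S :\ u) = d.+1.
  by case: (m _) => [|d]; [left|right; exists d].
rewrite md ltnS; apply: mup0_ge => // i hi.
rewrite (rec_coef Su) ?md ?ltnS ?(ltnW hi) // big1 ?oppr0 // => y /andP[Fy _].
by apply: lowz_mup; have := mult_le_del Fy; rewrite md /zmult; lia.
Qed.

(** Multiplied by the lowest coefficient of [Z (S :\ a)], the neighbour terms at index [d] all have
    the same sign, and that of [y] is nonzero; hence the coefficient of [Z S] at [d] survives. *)
Lemma essential_neighbour_positive S a y : a \in S -> y \in S :\ a -> e a y ->
  (m (S :\ a :\ y)).+1 = m (S :\ a) -> m (S :\ a) = (m S).+1.
Proof.
move=> Sa Fy eay ess; set d := m (S :\ a :\ y) in ess.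
suff le_d : (m S <= d)%N by have := mult_del_le Sa; lia.
apply: mup0_le; rewrite (rec_coef Sa) -?ess // oppr_eq0.
apply/eqP=> /(congr1 (fun c => (Z (S :\ a))`_d.+1 * c)); rewrite mulr0 mulr_sumr.
move=> /eqP; rewrite psumr_eq0; last first.
  by move=> w /andP[Fw _]; rewrite (essential_low_sign Fw (esym ess)).
move=> /allP /(_ y (mem_index_enum _)); rewrite Fy eay eq_sym.
by rewrite (essential_low_sign Fy (esym ess)) eqxx.
Qed.

(** Otherwise interlacing forces [m (S :\ u) = m (S :\ u :\ w) = m S], and the sum of squares of
    [christoffel_darboux] would have the odd order [2 * m S - 1]. *)
Lemma essential_del S u w : u \in S -> w \in S -> u != w ->
  (m (S :\ w)).+1 = m S -> (m S <= m (S :\ u))%N ->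
  (m (S :\ u :\ w)).+1 = m (S :\ u).
Proof.
move=> Su Sw neq_uw ess noness.
have Fw : w \in S :\ u by rewrite !inE eq_sym neq_uw.
have Fu : u \in S :\ w by rewrite !inE neq_uw.
have h1 := mult_del_le Su; have h2 := mult_le_del Fw; have h3 := mult_del_le Fu.
rewrite setD1C in h3.
have [//|neq] := eqVneq (m (S :\ u :\ w)).+1 (m (S :\ u)).
have := @sos_sub_even R _ _ _ (christoffel_darboux recZ Su Sw neq_uw).
by rewrite mulf_neq0 // !mupM // -/(m _) -/(m _) -/(m _) -/(m _) => /(_ isT); lia.
Qed.

(* Essential vertices [u], [v] are parallel when deleting both drops the
   multiplicity by one only; this is the transitivity of parallelism. The
   weight of [u] is shifted by [lam * 'X]: the Christoffel-Darboux sum of squares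
   for [w], [y] has a coefficient that is affine and non-constant in [lam],
   hence takes a negative value. *)
Lemma essential_exchange S u w y d :
  u \in S -> w \in S -> y \in S -> u != w -> u != y -> w != y ->
  m S = d.+2 -> m (S :\ u) = d.+1 -> m (S :\ w :\ y) = d ->
  m (S :\ u :\ w) = d \/ m (S :\ u :\ y) = d.
Proof.
move=> Su Sw Sy uw uy wy mS mu mwy.
have Fuw : w \in S :\ u by rewrite !inE eq_sym uw.
have Fuy : y \in S :\ u by rewrite !inE eq_sym uy.
have Fuwy : y \in S :\ u :\ w by rewrite !inE eq_sym wy eq_sym uy.
have := mult_le_del Fuw; have := mult_le_del Fuy; rewrite mu !ltnS => guy guw.
have := mult_le_del Sw; have := mult_le_del Sy; rewrite mS !ltnS => gy gw.
have guwy := mult_le_del Fuwy.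
have [->|nuw] := eqVneq (m (S :\ u :\ w)) d; first by left.
have [->|nuy] := eqVneq (m (S :\ u :\ y)) d; first by right.
have {}guw : (d < m (S :\ u :\ w))%N by rewrite ltn_neqAle eq_sym nuw.
have {}guy : (d < m (S :\ u :\ y))%N by rewrite ltn_neqAle eq_sym nuy.
have {}guwy : (d <= m (S :\ w :\ y :\ u))%N.
  rewrite [S :\ w :\ y :\ u]setD1C [S :\ w :\ u]setD1C -ltnS.
  exact: leq_trans guwy.
have eq_d : (d.+2 + d = d.+1 + d.+1)%N by rewrite addSnnS.
exfalso.
have cu : (Z (S :\ u))`_d.+1 != 0 by rewrite -mu low_neq0.
have cwy : (Z (S :\ w :\ y))`_d != 0 by rewrite -mwy low_neq0.
(* [lam] solves for the value -1 of the coefficient at [d.+1 + d.+1]. *)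
pose lam := (((Z (S :\ w))`_d.+1 * (Z (S :\ y))`_d.+1 + 1) / (Z (S :\ w :\ y))`_d
             - (Z S)`_d.+2) / (Z (S :\ u))`_d.+1.
have := christoffel_darboux (matching_rec_shift u ('X * lam%:P) recZ) Sw Sy wy.
rewrite /= !in_setD1 Su uw uy /= -!mulrA.
(* The factor ['X] raises the corrections by one order, so that of the four coefficients read off
   below only the one of [Z S] changes. *)
have lowX n S' : (n <= m S')%N -> lowz n.+1 ('X * (lam%:P * Z S')).
  by move=> hn; apply: lowzXM => i hi; rewrite coefCM lowz_mup ?mulr0 //;
     apply: leq_trans hn.
have lowD n p q : lowz n p -> lowz n q -> lowz n (p + q : {poly R}).
  by move=> hp hq i hi; rewrite coefD hp ?hq ?addr0.
have low n S' : (n <= m S')%N -> lowz n (Z S').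
  by move=> hn; apply: lowzW hn (@lowz_mup _ _).
rewrite [S :\ w :\ u]setD1C [S :\ y :\ u]setD1C.
set p1 := Z (S :\ w) + _; set p2 := Z (S :\ y) + _.
set p3 := Z S + _; set p4 := Z (S :\ w :\ y) + _ => hs.
have l1 : lowz d.+1 p1.
  by apply: lowD; [apply: low|apply: (lowzW (leqnSn _)); apply: lowX].
have l2 : lowz d.+1 p2.
  by apply: lowD; [apply: low|apply: (lowzW (leqnSn _)); apply: lowX].
have l3 : lowz d.+2 p3.
  by apply: lowD; [apply: low; rewrite mS|apply: lowX; rewrite mu].
have l4 : lowz d p4.
  apply: lowD; first by apply: low; rewrite mwy.
  by apply: (lowzW (leqnSn _)); apply: lowX.
have c1 : p1`_d.+1 = (Z (S :\ w))`_d.+1 by rewrite coefD (lowX _ _ guw) ?addr0.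
have c2 : p2`_d.+1 = (Z (S :\ y))`_d.+1 by rewrite coefD (lowX _ _ guy) ?addr0.
have c3 : p3`_d.+2 = (Z S)`_d.+2 + lam * (Z (S :\ u))`_d.+1.
  by rewrite coefD coefXM coefCM.
have c4 : p4`_d = (Z (S :\ w :\ y))`_d by rewrite coefD (lowX _ _ guwy) ?addr0.
have [low12 c12] := lowzM l1 l2; have [low34 c34] := lowzM l3 l4.
rewrite eq_d in low34 c34.
have cm1 : (p1 * p2 - p3 * p4)`_(d.+1 + d.+1) = -1.
  rewrite coefB c12 c34 c1 c2 c3 c4 /lam.
  by field; rewrite cu cwy.
have lowp : lowz (d.+1 + d.+1) (p1 * p2 - p3 * p4).
  by move=> i hi; rewrite coefB low12 // low34 // subr0.
have neq0 : (p1 * p2 - p3 * p4)`_(d.+1 + d.+1) != 0 by rewrite cm1 oppr_eq0 oner_eq0.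
have [|n [mn pos]] := sos_low hs.
  by apply: contraNneq neq0 => ->; rewrite coef0.
move: pos; rewrite -mn (mup0_eq lowp neq0) cm1.
by rewrite ltr0N1.
Qed.

(** * Essential and special vertices, stability and extremality *)

Definition essential_in S u := (m (S :\ u)).+1 == m S.

Definition special_in S a :=
  ~~ essential_in S a && [exists w, e a w && essential_in S w].

Lemma essential_in_mem S u : essential_in S u -> u \in S.
Proof.
apply: contraTT => nSu; rewrite /essential_in.
by have /setDidPl-> : [disjoint S & [set u]]; [rewrite disjoint_sym disjoints1|lia].
Qed.

Lemma nonessential_le S u : u \in S -> ~~ essential_in S u ->
  (m S <= m (S :\ u))%N.
Proof. by move=> /mult_le_del; rewrite /essential_in; lia. Qed.

Lemma essential_in_del S u w : u \in S -> ~~ essential_in S u ->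
  essential_in S w -> essential_in (S :\ u) w.
Proof.
move=> Su nu ew; have Sw := essential_in_mem ew; apply/eqP.
apply: essential_del => //; last exact: nonessential_le.
  by apply: contraNneq nu => ->.
exact/eqP.
Qed.

(** The essential neighbour of [a] stays essential in [S :\ a], which makes [a] positive. *)
Lemma special_positive S a : a \in S -> special_in S a -> m (S :\ a) = (m S).+1.
Proof.
move=> Sa /andP[na /existsP[w /andP[eaw ew]]].
have ew' := essential_in_del Sa na ew.
exact: essential_neighbour_positive Sa (essential_in_mem ew') eaw (eqP ew').
Qed.

(* Only the case where [u] is positive resists counting. If [a] were essential
   in [S :\ u], then [u] would be parallel in [S :\ a] to every neighbour of
   [a]; but [a] must have a neighbour [y] not parallel to [w], for otherwise
   [w] would not be essential in [S]. *)
Lemma stability S a u : a \in S -> special_in S a -> u \in S -> u != a ->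
  m (S :\ a :\ u) = (m (S :\ u)).+1.
Proof.
move=> Sa spa Su ua; have pos_a := special_positive Sa spa.
have /andP[na /existsP[w /andP[eaw ew]]] := spa.
have Fa : a \in S :\ u by rewrite !inE eq_sym ua.
have Fu : u \in S :\ a by rewrite !inE ua.
have gua := mult_del_le Fa; have gau := mult_le_del Fu.
have [/eqP eu|nu] := boolP (essential_in S u).
  by move: gua gau eu pos_a; rewrite setD1C; clear; lia.
have ewu := essential_in_del Su nu ew.
have [ea|na'] := boolP (essential_in (S :\ u) a); last first.
  rewrite setD1C; apply: special_positive => //.
  by rewrite /special_in na' /=; apply/existsP; exists w; rewrite eaw.
exfalso; have := eqP ea; rewrite setD1C => mu.
have hu := mult_del_le Su.
have [k kE] : exists k, m S = k by exists (m S).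
rewrite kE in pos_a hu.
have {mu} [mu mau] : m (S :\ u) = k.+1 /\ m (S :\ a :\ u) = k.
  by move: mu gua gau hu pos_a; rewrite setD1C; clear; lia.
have mw : (m (S :\ w)).+1 = k by rewrite -kE; exact/eqP.
have ewa := essential_in_del Sa na ew.
have maw : m (S :\ a :\ w) = k by apply/eq_add_S; rewrite (eqP ewa).
have Fw := essential_in_mem ewa.
have uw : u != w by apply: contraNneq nu => ->.
have k_gt0 : k = k.-1.+1 by rewrite -mw.
(* Otherwise [y] would be an essential neighbour of [a] after both deletions, making [a] positive in
   [S :\ u], where it is assumed essential. *)
have parallel y : y \in S :\ a -> e a y -> u != y -> m (S :\ a :\ u :\ y) != k.-1.
  move=> Fy eay uy; apply/eqP => may.
  have: m (S :\ u :\ a) = (m (S :\ u)).+1.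
    apply: (essential_neighbour_positive Fa _ eay).
      by move: Fy; rewrite !inE [y == u]eq_sym uy.
    by rewrite [S :\ u :\ a]setD1C mau may -k_gt0.
  by rewrite [S :\ u :\ a]setD1C mau mu; clear; lia.
have wa : a \in S :\ w.
  by rewrite !inE Sa andbT; apply: contraTneq Fw => ->; rewrite !inE eqxx.
(* The coefficient of [Z (S :\ w)] at [k.-1] is nonzero; the recursion at [a] makes it a sum over
   neighbours, one of which contributes. *)
have [y [Fy eay may]] : exists y,
    [/\ y \in S :\ a :\ w, e a y & (m (S :\ a :\ w :\ y) <= k.-1)%N].
  have : (Z (S :\ w))`_k.-1 != 0.
    by rewrite -mw; apply: low_neq0.
  rewrite (rec_coef wa) [S :\ w :\ a]setD1C ?maw; last by rewrite -mw.
  rewrite oppr_eq0 => /negP sum_neq0.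
  have [/existsP[y /and3P[h1 h2 h3]]|/existsPn none] :=
      boolP [exists y, [&& y \in S :\ a :\ w, e a y
                         & (Z (S :\ a :\ w :\ y))`_k.-1 != 0]].
    by exists y; split=> //; apply: mup0_le.
  exfalso; apply: sum_neq0; rewrite big1 // => y /andP[h1 h2].
  by have := none y; rewrite h1 h2 negbK => /eqP.
have Fy' : y \in S :\ a by move: Fy; rewrite inE => /andP[].
have wy : w != y by move: Fy; rewrite !inE eq_sym => /andP[].
have gy := mult_le_del Fy.
have {gy} may' : m (S :\ a :\ w :\ y) = k.-1.
  by move: gy may; rewrite maw; clear; lia.
have uy : u != y.
  apply: contraTneq (parallel w Fw eaw uw) => ->.
  by rewrite [S :\ a :\ y :\ w]setD1C may' eqxx.
(* [w] and [y] are not parallel in [S :\ a], so one of them is not parallel to [u], contradicting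
   [parallel]. *)
have := @essential_exchange (S :\ a) u w y k.-1 Fu Fw Fy' uw uy wy.
rewrite pos_a mau may' -k_gt0 => /(_ erefl erefl erefl)[] /eqP.
  exact/negP/parallel.
exact/negP/parallel.
Qed.

Lemma special_in_del_special S a b : a \in S -> b \in S -> b != a ->
  special_in S a -> special_in S b -> special_in (S :\ a) b.
Proof.
move=> Sa Sb ba spa /andP[nb /existsP[w /andP[ebw ew]]].
have /andP[na _] := spa; apply/andP; split.
  by move: nb; rewrite /essential_in stability // (special_positive Sa spa).
apply/existsP; exists w; rewrite ebw; exact: essential_in_del.
Qed.

Lemma special_in_del S u a : u \in S -> a \in S ->
  ~~ essential_in S u -> ~~ special_in S u ->
  special_in S a -> special_in (S :\ u) a.
Proof.
move=> Su Sa nu nspu spa; have /andP[na /existsP[w /andP[eaw ew]]] := spa.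
have ua : u != a by apply: contraNneq nspu => ->.
apply/andP; split.
  by rewrite /essential_in [S :\ u :\ a]setD1C stability //; clear; lia.
apply/existsP; exists w; rewrite eaw; exact: essential_in_del.
Qed.

(** Peel off [a] from [X]: stability yields one unit, and the rest of [X] stays special in
    [S :\ a]. *)
Lemma special_extreme_del S X v : X \subset S -> v \in S :\: X ->
  (forall a, a \in X -> special_in S a) ->
  m ((S :\: X) :\ v) = (m (S :\ v) + #|X|)%N.
Proof.
have [n] := ubnP #|X|; elim: n => // n IHn in S X *.
have [->|[a Xa]] := set_0Vmem X; first by rewrite setD0 cards0 addn0.
move=> leXn sXS vSX spX; have Sa := subsetP sXS a Xa.
have cX := cardsD1 a X; rewrite Xa add1n in cX; rewrite cX ltnS in leXn.
have /andP[nXv Sv] : (v \notin X) && (v \in S) by move: vSX; rewrite inE.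
have va : v != a by apply: contraNneq nXv => ->.
have eqD : (S :\ a) :\: (X :\ a) = S :\: X.
  by rewrite setDDl setD1K.
have := IHn (S :\ a) (X :\ a) leXn; rewrite eqD => -> //.
- by rewrite stability ?spX // cX addSnnS.
- by rewrite setSD.
- move=> b; rewrite !inE => /andP[ba Xb].
  by apply: special_in_del_special; rewrite ?spX //; apply: (subsetP sXS).
Qed.

Lemma special_extreme_del2 S u v : u \in S -> v \in S -> u != v ->
  ~~ essential_in S u -> ~~ special_in S u -> ~~ special_in S v ->
  m (S :\: ([set a in S | special_in S a] :|: [set u; v]))
    = (m (S :\: [set u; v]) + #|[set a in S | special_in S a]|)%N.
Proof.
move=> Su Sv uv nu nspu nspv; set X := [set a in S | _].
have -> : S :\: [set u; v] = S :\ u :\ v by rewrite setDDl.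
have -> : S :\: (X :|: [set u; v]) = ((S :\ u) :\: X) :\ v.
  by rewrite setUA [X :|: [set u]]setUC -!setDDl.
apply: special_extreme_del.
- apply/subsetP => a; rewrite !inE => /andP[-> spa]; rewrite andbT.
  by apply: contraNneq nspu => <-.
- by rewrite !inE (negPf nspv) andbF eq_sym uv Sv.
- by move=> a; rewrite inE => /andP[Sa]; apply: special_in_del.
Qed.

End Multiplicity.
End MatchingRecursion.

(** * The matching polynomial satisfies the recursion *)

Section MatchingPolynomial.
Variables (T : finType) (e : rel T).
Hypothesis e_simple : simple_graph e.
Implicit Types (S : {set T}) (M : {set {set T}}).

Lemma is_matchingP S M : reflect
  [/\ forall E, E \in M -> exists a b, e a b /\ E = [set a; b],
      forall E, E \in M -> E \subset S & trivIset M] (is_matching e S M).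
Proof.
rewrite /is_matching -andbA; apply: (iffP and3P) => [] [h1 h2 h3]; split=> //.
- move=> E EM; move/forall_inP: h1 => /(_ E EM) /existsP[a /existsP[b]].
  by move=> /andP[eab /eqP->]; exists a, b.
- by move=> E EM; move/forall_inP: h2; apply.
- apply/forall_inP => E /h1[a [b [eab ->]]].
  by apply/existsP; exists a; apply/existsP; exists b; rewrite eab eqxx.
- exact/forall_inP.
Qed.

Lemma matching_edge_card S M E : is_matching e S M -> E \in M -> #|E| = 2%N.
Proof.
move=> /is_matchingP[h _ _] /h[a [b [eab ->]]]; rewrite cards2.
case: eqVneq eab => // ->; case: e_simple => _ irr; by rewrite irr.
Qed.

Lemma matching_card S M : is_matching e S M -> (#|M|.*2 <= #|S|)%N.
Proof.
move=> hM; have /is_matchingP[_ sub tri] := hM.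
have -> : #|M|.*2 = #|cover M|.
  move: tri; rewrite /trivIset => /eqP<-.
  rewrite (eq_bigr (fun=> 2%N)) ?sum_nat_const ?muln2 //.
  by move=> E; apply: matching_edge_card hM.
by apply: subset_leq_card; apply/bigcupsP => E; apply: sub.
Qed.

Lemma matching_del S M u :
  is_matching e (S :\ u) M = is_matching e S M && (u \notin cover M).
Proof.
apply/is_matchingP/andP => [[h1 h2 h3]|[/is_matchingP[h1 h2 h3] nu]]; split=> //.
- by apply/is_matchingP; split=> // E /h2; rewrite subsetD1 => /andP[].
- by apply/bigcupP => -[E /h2]; rewrite subsetD1 => /andP[_ /negP].
- move=> E EM; rewrite subsetD1 h2 //=; apply: contra nu => uE.
  by apply/bigcupP; exists E.
Qed.

Lemma matching_add_edge S M u y : u \in S -> y \in S -> e u y ->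
  is_matching e S ([set u; y] |: M) && ([set u; y] \notin M)
    = is_matching e (S :\ u :\ y) M.
Proof.
move=> Su Sy euy.
apply/andP/is_matchingP => [[/is_matchingP[h1 h2 h3] nM]|[h1 h2 h3]].
  have MU E : E \in M -> E \in [set u; y] |: M by move=> EM; rewrite !inE EM orbT.
  split=> [E /MU/h1//|E EM|]; last first.
    by apply: trivIsetS h3; apply: subsetUr.
  have neqE : [set u; y] != E by apply: contraNneq nM => ->.
  have := trivIsetP h3 _ _ (setU11 _ _) (MU _ EM) neqE.
  rewrite disjoint_subset => /subsetP dis.
  rewrite !subsetD1 h2 ?MU //=.
  by have := dis u; have := dis y; rewrite !inE !eqxx orbT /= => -> // ->.
have dis : {in M, forall E : {set T}, [disjoint [set u; y] & E]}.
  move=> E /h2; rewrite !subsetD1 => /andP[/andP[_ uE] yE].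
  by rewrite disjoint_subset; apply/subsetP => z; rewrite !inE => /orP[]/eqP->.
have n0 : set0 \notin M.
  apply/negP => /h1[a [b [_ /setP/(_ a)]]]; by rewrite !inE eqxx.
have [tri nM] := trivIsetU1 dis h3 n0; split=> //; apply/is_matchingP; split=> //.
  by move=> E; rewrite !inE => /orP[/eqP->|/h1//]; exists u, y.
move=> E; rewrite !inE => /orP[/eqP->|/h2].
  by apply/subsetP => z; rewrite !inE => /orP[]/eqP->.
by rewrite !subsetD1 => /andP[/andP[]].
Qed.

(** An equality of predicates, so that a sum over possible partners of [u] collapses to one term. *)
Lemma matching_cover_edge S M u : is_matching e S M -> u \in cover M ->
  exists2 z, [set u; z] \in M & forall y,
    [&& y \in S :\ u, e u y & [set u; y] \in M] = (y == z).
Proof.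
move=> hM uM; have /is_matchingP[edge sub tri] := hM.
case/bigcupP: uM => E EM uE.
have [z [euz defE]] : exists z, e u z /\ E = [set u; z].
  have [a [b [eab defE]]] := edge E EM; move: uE; rewrite defE !inE.
  case/orP=> /eqP->; first by exists b.
  by exists a; case: e_simple => sym _; rewrite sym setUC.
rewrite defE in EM; exists z => // y; apply/and3P/eqP => [[yS euy yM]|->].
  have [eqE|neqE] := eqVneq [set u; y] [set u; z].
    have /setP/(_ y) := eqE; rewrite !inE eqxx orbT.
    by case: eqVneq yS => [->|_ _ /esym/eqP//]; rewrite !inE eqxx.
  have := trivIsetP tri _ _ yM EM neqE; rewrite disjoint_subset => /subsetP/(_ u).
  by rewrite !inE eqxx => /(_ isT).
split=> //; rewrite !inE; apply/andP; split.
  by apply: contraTneq euz => ->; case: e_simple => _ ->.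
by have /subsetP/(_ z) := sub _ EM; apply; rewrite !inE eqxx orbT.
Qed.

Variable R : comNzRingType.

Lemma match_polyE S : match_poly e R S =
  \sum_(M | is_matching e S M) (-1) ^+ #|M| *: 'X^(#|S| - #|M|.*2).
Proof.
rewrite (partition_big (fun M => inord #|M| : 'I_(#|S|./2).+1) predT) //=.
apply: eq_bigr => r _.
have eqM M : is_matching e S M -> (inord #|M| == r) = (#|M| == r :> nat).
  move=> /matching_card hM; rewrite -val_eqE /= inordK //.
  by rewrite ltnS -(doubleK #|M|) half_leq.
rewrite (eq_bigr (fun=> (-1) ^+ r *: 'X^(#|S| - r.*2))); last first.
  by move=> M /andP[hM]; rewrite eqM // => /eqP->.
rewrite (eq_bigl (fun M => M \in [set M | is_matching e S M & #|M| == r]));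
  last first.
  by move=> M; rewrite inE; apply: andb_id2l => /eqM.
by rewrite sumr_const -scaler_nat scalerA; congr (_ *: _); apply: commr_nat.
Qed.

Lemma match_poly_neq0 S : match_poly e R S != 0.
Proof.
suff : (match_poly e R S)`_#|S| != 0 by apply: contraNneq => ->; rewrite coef0.
rewrite match_polyE coef_sum (bigD1 set0) /=; last first.
  apply/is_matchingP; split=> [E|E|]; rewrite ?inE //.
  by apply/trivIsetP => E; rewrite inE.
rewrite cards0 subn0 scale1r coefXn eqxx big1 ?addr0 ?oner_eq0 // => M /andP[hM M0].
have := matching_card hM; have : (0 < #|M|)%N by rewrite card_gt0.
rewrite coefZ coefXn => h1 h2.
suff -> : (#|S| == #|S| - #|M|.*2)%N = false by rewrite mulr0.
by lia.
Qed.

Lemma match_poly_rec S u : u \in S ->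
  match_poly e R S = 'X * match_poly e R (S :\ u)
    - \sum_(y in S :\ u | e u y) match_poly e R (S :\ u :\ y).
Proof.
move=> Su; rewrite match_polyE (bigID (fun M => u \notin cover M)) /=.
congr (_ + _).
  rewrite match_polyE mulr_sumr; apply: eq_big => M; first by rewrite matching_del.
  rewrite -matching_del => /matching_card hM.
  by rewrite -scalerAr -exprS (cardsD1 u S) Su add1n subSn.
pose t M : {poly R} := (-1) ^+ #|M| *: 'X^(#|S| - #|M|.*2).
(* A one-term sum over the partner [y] of [u] is inserted and exchanged with the sum over [M];
   removing the edge then flips the sign. *)
rewrite (eq_bigr (fun M =>
    \sum_(y | [&& y \in S :\ u, e u y & [set u; y] \in M]) t M)).
  rewrite (exchange_big_dep (fun y => (y \in S :\ u) && e u y)) /=; last first.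
    by move=> M y _ /and3P[-> ->].
  rewrite -sumrN; apply: eq_bigr => y /andP[yF euy].
  rewrite match_polyE -sumrN.
  rewrite (reindex_onto (fun M => [set u; y] |: M)
    (fun M => M :\ [set u; y])) /=; last first.
    by move=> M /andP[_ /and3P[_ _ yM]]; rewrite setD1K.
  have yS : y \in S by move: yF; rewrite inE => /andP[].
  have cS : #|S| = (#|S :\ u :\ y|).+2.
    by rewrite (cardsD1 u S) Su (cardsD1 y (S :\ u)) yF.
  apply: eq_big => M.
    rewrite -(matching_add_edge M Su yS euy) yF euy setU11 !andbT negbK.
    have uC : u \in cover ([set u; y] |: M).
      by apply/bigcupP; exists [set u; y]; rewrite !inE eqxx.
    rewrite uC andbT; congr (_ && _); apply/eqP/idP => [<-|]; last exact: setU1K.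
    by rewrite !inE eqxx.
  move=> /andP[_ /eqP eqM]; have nM : [set u; y] \notin M by rewrite -eqM !inE eqxx.
  rewrite /t cardsU1 nM add1n cS doubleS !subSS exprS mulN1r scaleNr //.
move=> M /andP[hM]; rewrite negbK => uM.
have [z zM eqz] := matching_cover_edge hM uM.
by rewrite (eq_bigl _ _ eqz) big_pred1_eq.
Qed.

End MatchingPolynomial.

(** * Translation of [theta] to 0 and the theorem *)

Lemma mup_comp_shift (R : fieldType) (c : R) (p : {poly R}) : p != 0 ->
  mup 0 (p \Po ('X + c%:P)) = mup c p.
Proof.
move=> p0; have [n [q]] := multiplicity_XsubC p c; rewrite p0 /= => qc ->.
have -> : (q * ('X - c%:P) ^+ n) \Po ('X + c%:P)
    = (q \Po ('X + c%:P)) * ('X - 0%:P) ^+ n.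
  by rewrite comp_polyM rmorphXn /= comp_polyB comp_polyX comp_polyC addrK subr0.
rewrite !mupMr ?mup_XsubCX ?eqxx //.
by rewrite /root horner_comp !hornerE.
Qed.

Theorem theorem5p16 (T : finType) (e : rel T) (R : realFieldType) (theta : R)
  (u v : T) :
  simple_graph e ->
  u != v ->
  u \in P_set e theta :|: N_set e theta ->
  v \in P_set e theta :|: N_set e theta ->
  mult e theta (A_set e theta :|: [set u; v])
    = (mult e theta [set u; v] + #|A_set e theta|)%N.
Proof.
move=> e_simple uv uPN vPN.
(* The translation turns all weights into ['X + theta%:P], whose derivative is still 1. *)
pose Z S := match_poly e R S \Po ('X + theta%:P).
have mZ X : mult e theta X = mup 0 (Z (~: X)).
  by rewrite mup_comp_shift ?match_poly_neq0.
have mE X : mult e theta X = mup 0 (Z ([set: T] :\: X)) by rewrite mZ setTD.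
have recZ : matching_rec e (fun=> 'X + theta%:P) Z.
  move=> S a Sa; rewrite /Z (match_poly_rec e_simple R Sa).
  rewrite comp_polyB comp_polyM comp_polyX; congr (_ - _).
  exact: (big_morph _ (fun p q => comp_polyD p q _) (comp_poly0 _)).
have dx (w : T) : ('X + theta%:P)^`() = 1 :> {poly R}.
  by rewrite derivD derivX derivC addr0.
have Z_neq0 S : Z S != 0.
  by rewrite /Z comp_poly2_eq0 ?match_poly_neq0 // size_XaddC.
have essE w : essential e theta w = essential_in Z [set: T] w.
  by rewrite /essential /essential_in !mE setD0.
have spE w : special e theta w = special_in e Z [set: T] w.
  rewrite /special /special_in essE; congr (_ && _).
  by apply: eq_existsb => z; rewrite essE.
have AE : A_set e theta = [set a in [set: T] | special_in e Z [set: T] a].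
  by apply/setP => a; rewrite !inE spE.
have class w : w \in P_set e theta :|: N_set e theta ->
    ~~ essential_in Z [set: T] w /\ ~~ special_in e Z [set: T] w.
  rewrite !inE -essE -spE /positive /neutral /essential.
  case/orP=> [/andP[/eqP-> ->]|/eqP mw]; split=> //; rewrite ?mw; try by clear; lia.
  (* A neutral vertex cannot be special, since special vertices are positive. *)
  apply/negP; rewrite spE => /(special_positive recZ dx Z_neq0 (in_setT w)).
  by rewrite /zmult -mE -[in X in _ = X.+1](setD0 [set: T]) -mE mw; clear; lia.
have [nu nspu] := class u uPN; have [_ nspv] := class v vPN.
rewrite !mE AE.
exact: (special_extreme_del2 recZ dx Z_neq0 (in_setT u) (in_setT v) uv nu nspu nspv).
Qed.
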